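(* Let $X$ be a Banach space and $x\in S_X$. Assume that for every convex combination of slices $C$ of $B_X$ we have $\sup_{y\in C}\max_{\theta\in\mathbb{T}}\|x+\theta y\|=2$. Then $x$ is a ccs Daugavet point.
   Context: Banach spaces are over $\mathbb{K}$ ($\mathbb{R}$ or $\mathbb{C}$); $B_X$, $S_X$ denote the closed unit ball and the unit sphere of $X$; $\mathbb{T}=\{\theta\in\mathbb{K}:|\theta|=1\}$. A slice of $B_X$ is a set of the form $\{y\in B_X:\mathrm{Re}\,x^*(y)>\sup\mathrm{Re}\,x^*(B_X)-\alpha\}$ with $x^*\in X^*\setminus\{0\}$ and $\alpha>0$. A convex combination of slices of $B_X$ is a set $\sum_{i=1}^n\lambda_iS_i$ with $n\in\mathbb{N}$, $S_i$ slices of $B_X$, $\lambda_i>0$ and $\sum_{i=1}^n\lambda_i=1$. A point $x\in S_X$ is a ccs Daugavet point if $\sup_{y\in C}\|x+y\|=2$ for every convex combination of slices $C$ of $B_X$. *)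

(* Defs.v *)
From HB Require Import structures.
From mathcomp Require Import all_boot all_order all_algebra.
From mathcomp Require Import all_classical all_reals.
From mathcomp Require Import topology normedtype.
From mathcomp Require Import complex.

Set Implicit Arguments.
Unset Strict Implicit.
Unset Printing Implicit Defensive.

Import Order.TTheory GRing.Theory Num.Theory.
Import numFieldNormedType.Exports.

Local Open Scope classical_set_scope.
Local Open Scope ring_scope.

(* [real_or_complex re] says that the scalar field K is either R or C = R[i]
   and that re : K -> R is the real part. The norm of a normed module over K
   takes its values in K, so [re `|y|] is the norm of y as an element of R. *)
Variant real_or_complex (R : realType) :
    forall K : numFieldType, (K -> R) -> Prop :=
  | ScalarReal : @real_or_complex R R id
  | ScalarComplex : @real_or_complex R R[i] (@complex.Re R).

Definition unit_ball (K : numFieldType) (X : normedModType K) : set X :=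
  [set y | `|y| <= 1].

Definition unit_sphere (K : numFieldType) (X : normedModType K) : set X :=
  [set y | `|y| = 1].

Definition unit_scalars (K : numFieldType) : set K := [set t | `|t| = 1].

(* The greatest element of A, or 0 if A has none. *)
Definition set_max (R : realType) (A : set R) : R := xget 0 (A `&` ubound A).

Definition is_slice (R : realType) (K : numFieldType) (re : K -> R)
    (X : normedModType K) (S : set X) : Prop :=
  exists (f : {linear X -> K^o}) (a : R),
    [/\ continuous f,
        exists y, f y != 0,
        0 < a &
        S = [set y | unit_ball y /\
                     sup [set re (f z) | z in @unit_ball K X] - a < re (f y)]].

(* The weights l i are taken in K; [0 < l i] makes them positive reals, since
   the order of R[i] only compares numbers with equal imaginary parts. *)
Definition is_ccs (R : realType) (K : numFieldType) (re : K -> R)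
    (X : normedModType K) (C : set X) : Prop :=
  exists (n : nat) (l : 'I_n -> K) (S : 'I_n -> set X),
    [/\ forall i, 0 < l i,
        \sum_(i < n) l i = 1,
        forall i, is_slice re (S i) &
        C = [set y | exists2 s : 'I_n -> X,
               forall i, S i (s i) & y = \sum_(i < n) l i *: s i]].

Definition ccs_Daugavet_point (R : realType) (K : numFieldType) (re : K -> R)
    (X : normedModType K) (x : X) : Prop :=
  unit_sphere x /\
  forall C : set X, is_ccs re C -> sup [set re `|x + y| | y in C] = 2.

(* Main.v *)
(** Fix a finite family (t_j), j in J, of unit scalars such that every unit
    scalar t satisfies |t t_j - 1| <= d for some j.  The average over j of the
    rotated sets t_j C is again a convex combination of slices, so it contains
    some y = (1/#|J|) \sum_j t_j y_j, with y_j in C, such that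
    ||x + t y|| > 2 - d / #|J| for some unit scalar t.  No term of an average of
    #|J| numbers bounded by 2 can then be smaller than 2 - d, and for the index j
    with t t_j close to 1 this gives ||x + y_j|| >= 2 - 2 d. *)
Require Import Defs.
From HB Require Import structures.
From mathcomp Require Import all_boot all_order all_algebra.
From mathcomp Require Import all_classical all_reals.
From mathcomp Require Import topology normedtype.
From mathcomp Require Import complex.
From mathcomp Require Import lra.

Set Implicit Arguments.
Unset Strict Implicit.
Unset Printing Implicit Defensive.

Import Order.TTheory GRing.Theory Num.Theory.
Import numFieldNormedType.Exports.

Local Open Scope classical_set_scope.
Local Open Scope ring_scope.

(** Cut $[-1,1]$ into finitely many cells of length at most [e]; [key] names the cell of a point.
    Naming cells rather than centres lets a pair of keys handle complex numbers. *)
Lemma itv_finite_key (R : realType) (e : R) : 0 < e ->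
  exists (N : nat) (key : R -> 'I_N), forall a b : R, `|a| <= 1 -> `|b| <= 1 ->
    key a = key b -> `|a - b| <= e.
Proof.
move=> e0; set M := (Num.truncn e^-1).+1.
have M0 : (0 : R) < M%:R by rewrite ltr0n.
have eM : 1 <= e * M%:R.
  by rewrite mulrC -ler_pdivrMr // div1r ltW // truncnS_gt.
(* Cells have length $1/M \le e$. The endpoint $a = 1$ gets index $2M$, hence $2M+1$ indices. *)
exists (M * 2).+1, (fun a => inord (Num.truncn ((a + 1) * M%:R))) => a b.
have trunc_bound (c : R) : `|c| <= 1 ->
    let k := Num.truncn ((c + 1) * M%:R) in
    k%:R <= (c + 1) * M%:R < k%:R + 1 /\ (k < (M * 2).+1)%N.
  rewrite ler_norml => /andP[c1 c2] k.
  have c0 : 0 <= (c + 1) * M%:R by apply: mulr_ge0; [lra | exact: ltW].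
  have /andP[k1 k2] := truncn_itv c0.
  split; first by rewrite k1 natr1.
  rewrite ltnS -(ler_nat R); apply: le_trans k1 _.
  by rewrite natrM mulrC ler_pM2l //; lra.
move=> /trunc_bound[/andP[a1 a2] aN] /trunc_bound[/andP[b1 b2] bN].
move=> /(congr1 (@nat_of_ord _)); rewrite !inordK // => ab.
rewrite ab in a1 a2; rewrite ler_norml.
by apply/andP; split; rewrite -(ler_pM2r M0); lra.
Qed.

Section RealPart.
Variables (R : realType) (K : numFieldType) (re : K -> R).
Hypothesis hK : real_or_complex re.

Lemma reD a b : re (a + b) = re a + re b.
Proof. by case: K re / hK a b => // -[a b] [c d]. Qed.

Lemma re_le a b : a <= b -> re a <= re b.
Proof. by case: K re / hK a b => // -[a b] [c d]; rewrite lecE => /andP[]. Qed.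

Lemma re_nat n : re n%:R = n%:R.
Proof.
case: K re / hK => //=.
by elim: n => [|n IH] //=; rewrite -addn1 !natrD raddfD /= IH.
Qed.

Lemma reM_ge0 a b : 0 <= a -> re (a * b) = re a * re b.
Proof.
case: K re / hK a b => // -[a b] [c d]; rewrite lecE /= => /andP[/eqP-> _].
by rewrite mul0r subr0.
Qed.

(** Over the complex numbers, key the real and imaginary parts separately with error $e/2$ each, and
    use $|u + iv| \le |u| + |v|$. *)
Lemma unit_scalars_key (e : R) : 0 < e ->
  exists (J : finType) (key : K -> J), forall s t, `|s| = 1 -> `|t| = 1 ->
    key s = key t -> re `|s - t| <= e.
Proof.
move=> e0; case: K re / hK.
  have [N [key keyP]] := itv_finite_key e0.
  by exists 'I_N, key => s t s1 t1; apply: keyP; rewrite ?s1 ?t1.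
have e2 : 0 < e / 2 by rewrite divr_gt0.
have [N [key keyP]] := itv_finite_key e2.
exists ('I_N * 'I_N)%type, (fun t : R[i] => (key (complex.Re t), key (complex.Im t))).
have Re_Im_le1 (s : R[i]) : `|s| = 1 -> `|complex.Re s| <= 1 /\ `|complex.Im s| <= 1.
  case: s => a b; rewrite normc_def /= => -[ab1].
  have a0 := sqr_ge0 a; have b0 := sqr_ge0 b.
  rewrite -ab1 -!sqrtr_sqr; split; apply: ler_wsqrtr; lra.
move=> s t /Re_Im_le1[s1 s2] /Re_Im_le1[t1 t2] [/(keyP _ _ s1 t1) d1 /(keyP _ _ s2 t2) d2].
move: s t d1 d2 {s1 s2 t1 t2} => [a b] [c d] /= d1 d2.
set u := a - c in d1 *; set v := b - d in d2 *.
apply: (@le_trans _ _ (`|u| + `|v|)); last by lra.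
rewrite -[leRHS]ger0_norm ?addr_ge0 // -[leRHS]sqrtr_sqr; apply: ler_wsqrtr.
rewrite [leRHS]sqrrD !real_normK ?num_real // lerD2r lerDl mulrn_wge0 //.
exact: mulr_ge0.
Qed.

(** Pick a unit representative [c j] of each key class, with the harmless default 1 for an empty
    class. The net consists of the inverses, because $|t c^{-1} - 1| = |t - c|$ when $|c| = 1$. *)
Lemma unit_scalars_net (e : R) : 0 < e ->
  exists (J : finType) (th : J -> K), (forall j, `|th j| = 1) /\
    forall t, `|t| = 1 -> exists j, re `|t * th j - 1| <= e.
Proof.
move=> e0; have [J [key keyP]] := unit_scalars_key e0.
pose c j := xget 1 [set t : K | `|t| = 1 /\ key t = j].
have c1 j : `|c j| = 1.
  by rewrite /c; case: xgetP => [y -> []|_] //; rewrite normr1.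
exists J, (fun j => (c j)^-1); split=> [j|t t1]; first by rewrite normfV c1 invr1.
exists (key t).
have ct : key t = key (c (key t)).
  by rewrite /c; case: xgetP => [y _ []|/(_ t) []].
have cN0 : c (key t) != 0 by rewrite -normr_gt0 c1.
have -> : `|t * (c (key t))^-1 - 1| = `|t - c (key t)|.
  by rewrite -[in LHS](divff cN0) -mulrBl normrM normfV c1 invr1 mulr1.
exact: keyP.
Qed.

Section Norm.
Variable X : normedModType K.
Implicit Types v w : X.

Lemma re_normD v w : re `|v + w| <= re `|v| + re `|w|.
Proof. by rewrite -reD; apply: re_le; apply: ler_normD. Qed.

Lemma re_normZ a v : re `|a *: v| = re `|a| * re `|v|.
Proof. by rewrite normrZ reM_ge0. Qed.

Lemma re_norm_sum (I : finType) (P : pred I) (F : I -> X) :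
  re `|\sum_(i | P i) F i| <= \sum_(i | P i) re `|F i|.
Proof.
elim/big_ind2: _ => [|v r w s vr ws|//]; first by rewrite normr0 (re_nat 0).
exact: le_trans (re_normD _ _) (lerD vr ws).
Qed.

Lemma re_unit_ball v : unit_ball v -> re `|v| <= 1.
Proof. by move=> /re_le; rewrite (re_nat 1). Qed.

Lemma is_slice_sub_ball (S : set X) : is_slice re S -> S `<=` @unit_ball K X.
Proof. by move=> [f [a [_ _ _ ->]]] y []. Qed.

(** The set is $t^{-1}S$. It is cut out by $z \mapsto f(tz)$ with the same [a]: the ball is
    invariant under multiplication by $t$, so the supremum is unchanged. *)
Lemma is_slice_rotate (t : K) (S : set X) : `|t| = 1 -> is_slice re S ->
  is_slice re [set y | S (t *: y)].
Proof.
move=> t1 [f [a [fc [y fy] a0 ->]]].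
have t0 : t != 0 by rewrite -normr_gt0 t1.
have ballZ z : unit_ball (t *: z) = @unit_ball K X z.
  by rewrite /unit_ball /= normrZ t1 mul1r.
have gE z : (t \*: f) z = f (t *: z) by rewrite /= linearZ.
exists (t \*: f), a; split => //.
- move=> z; apply: (@continuous_comp _ _ _ f (fun v : K^o => t *: v)).
    exact: fc.
  exact: scaler_continuous.
- by exists y; rewrite /= scaler_eq0 negb_or t0.
suff -> : [set re ((t \*: f) z) | z in @unit_ball K X]
    = [set re (f z) | z in @unit_ball K X].
  by apply/seteqP; split => z /=; rewrite ballZ -gE.
apply/seteqP; split => _ [z zB <-].
  by exists (t *: z); rewrite ?ballZ ?gE.
have tz : t *: (t^-1 *: z) = z by rewrite scalerA divff // scale1r.
by exists (t^-1 *: z); rewrite ?gE ?tz // -ballZ tz.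
Qed.

Lemma sum_enum_val (V : nmodType) (I : finType) (F : I -> V) :
  \sum_i F i = \sum_(k < #|I|) F (enum_val k).
Proof. by rewrite (reindex (@enum_val I I)) //; apply/onW_bij/enum_val_bij. Qed.

(** Allows any finite index type, so that the rotated slices can be indexed by pairs. *)
Lemma is_ccs_finType (I : finType) (l : I -> K) (S : I -> set X) :
  (forall i, 0 < l i) -> \sum_i l i = 1 -> (forall i, is_slice re (S i)) ->
  is_ccs re [set y | exists2 s : I -> X,
    forall i, S i (s i) & y = \sum_i l i *: s i].
Proof.
move=> l0 l1 hS; exists #|I|, (l \o enum_val), (S \o enum_val); split => //=.
  by rewrite -l1 -sum_enum_val.
apply/seteqP; split => y [s sS ->].
  by exists (s \o enum_val) => [i|]; [exact: sS | rewrite sum_enum_val].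
exists (s \o enum_rank) => [i|] /=.
  by rewrite -[i in S i]enum_rankK; apply: sS.
by rewrite [RHS]sum_enum_val; under [RHS]eq_bigr do rewrite enum_valK.
Qed.

Lemma is_ccs_sub_ball (C : set X) : is_ccs re C -> C `<=` @unit_ball K X.
Proof.
move=> [n [l [S [l0 l1 hS ->]]]] y [s sS ->]; rewrite /unit_ball /=.
apply: (le_trans (ler_norm_sum _ _ _)); rewrite -l1; apply: ler_sum => i _.
rewrite normrZ (gtr0_norm (l0 i)) ler_piMr ?(ltW (l0 i)) //.
exact: (is_slice_sub_ball (hS i)).
Qed.

(** Averaging the sets $\theta_j C$ amounts to combining the slices $\theta_j S_i$, over all pairs
    $(j,i)$, with weights $\lambda_i/|J|$. *)
Lemma is_ccs_rotation_average (J : finType) (th : J -> K) (C : set X) :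
  (0 < #|J|)%N -> (forall j, `|th j| = 1) -> is_ccs re C ->
  exists2 D : set X, is_ccs re D & forall y, D y ->
    exists2 z : J -> X, forall j, C (z j) &
      #|J|%:R *: y = \sum_j th j *: z j.
Proof.
move=> J0 th1 [n [l [S [l0 l1 hS ->]]]].
have m0 : (0 : K) < #|J|%:R by rewrite ltr0n.
have mN0 : #|J|%:R != 0 :> K by rewrite gt_eqF.
have thN0 j : th j != 0 by rewrite -normr_gt0 th1.
eexists.
  apply: (@is_ccs_finType (J * 'I_n)%type (fun p => #|J|%:R^-1 * l p.2)
    (fun p => [set y | S p.2 ((th p.1)^-1 *: y)])).
  - by move=> p; rewrite mulr_gt0 ?invr_gt0.
  - rewrite -(pair_bigA _ (fun _ i => #|J|%:R^-1 * l i)) /=.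
    under eq_bigr do rewrite -mulr_sumr l1 mulr1.
    by rewrite sumr_const -[LHS]mulr_natl divff.
  - by move=> p; apply: is_slice_rotate; rewrite ?normfV ?th1 ?invr1.
move=> _ [s sS ->].
(* Collect the terms with first index [j] and rotate them back into [C]. *)
exists (fun j => \sum_i l i *: ((th j)^-1 *: s (j, i))).
  by move=> j; exists (fun i => (th j)^-1 *: s (j, i)) => // i; apply: (sS (j, i)).
rewrite (eq_bigr (fun p => (#|J|%:R^-1 * l p.2) *: s (p.1, p.2))); last by case.
rewrite -(pair_bigA _ (fun j i => (#|J|%:R^-1 * l i) *: s (j, i))) /= scaler_sumr.
apply: eq_bigr => j _; rewrite !scaler_sumr; apply: eq_bigr => i _.
rewrite !scalerA mulrA divff // mul1r; congr (_ *: _).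
by rewrite mulrAC divff ?mul1r.
Qed.

End Norm.
End RealPart.

(* [sup] is 0 on sets without a supremum, so a nonzero value is attained up to
   any positive error. *)
Lemma sup_gt0_adherent (R : realType) (A : set R) (e : R) :
  0 < sup A -> 0 < e -> exists2 r, A r & sup A - e < r.
Proof.
move=> A0 e0; have [hA|/sup_out A00] := pselect (has_sup A).
  by have [r Ar ?] := sup_adherent e0 hA; exists r.
by rewrite A00 ltxx in A0.
Qed.

(** A positive value cannot be the default 0, so the maximum exists and is attained. *)
Lemma set_max_gt0_in (R : realType) (A : set R) : 0 < set_max A -> A (set_max A).
Proof. by rewrite /set_max; case: xgetP => [r _ []|_] //; rewrite ltxx. Qed.

Theorem proposition4p12 (R : realType) (K : numFieldType) (re : K -> R)
    (hK : real_or_complex re) (X : completeNormedModType K) (x : X)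
    (hx : unit_sphere x)
    (hmax : forall C : set X, is_ccs re C ->
      sup [set set_max [set re `|x + t *: y| | t in @unit_scalars K]
          | y in C] = 2) :
  ccs_Daugavet_point re x.
Proof.
split=> // C hC.
have le2 (t : K) y : `|t| = 1 -> C y -> re `|x + t *: y| <= 2.
  move=> t1 Cy; have y1 := re_unit_ball hK (is_ccs_sub_ball hC Cy).
  apply: le_trans (re_normD hK _ _) _.
  rewrite re_normZ // hx t1 (re_nat hK 1); lra.
have ub2 : ubound [set re `|x + y| | y in C] 2.
  by move=> _ [y Cy <-]; rewrite -[y]scale1r le2 // normr1.
(* One [e] is lost in the averaging, the other in replacing [t * th j] by 1. The bound $e < 1$ keeps
   the maximum over scalars positive, hence attained. *)
have near2 (e : R) : 0 < e < 1 -> exists2 y, C y & 2 - (e + e) <= re `|x + y|.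
  move=> /andP[e0 e1].
  have [J [th [th1 thP]]] := unit_scalars_net hK e0.
  have J0 : (0 < #|J|)%N.
    by have [j _] := thP 1 (normr1 _); apply/card_gt0P; exists j.
  have m0 : 0 < #|J|%:R :> R by rewrite ltr0n.
  have m1 : 1 <= #|J|%:R :> R by rewrite ler1n.
  have [D hD DP] := is_ccs_rotation_average J0 th1 hC.
  have em0 : 0 < e / #|J|%:R by rewrite divr_gt0.
  have em1 : e / #|J|%:R <= e by rewrite ler_pdivrMr // ler_peMr // ltW.
  have A2 := hmax D hD; set A := (X in sup X) in A2.
  have A0 : 0 < sup A by rewrite A2.
  have [_ [y /DP[z Cz yE] <-]] := sup_gt0_adherent A0 em0.
  rewrite A2 => far.
  have /set_max_gt0_in[t /= t1 tE] : 0 < set_max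
    [set re `|x + t *: y| | t in @unit_scalars K] by lra.
  rewrite -tE in far.
  have [j jP] := thP t t1; exists (z j) => //.
  have jfar : 2 - e < re `|x + (t * th j) *: z j|.
    have sumE : #|J|%:R *: (x + t *: y) = \sum_i (x + (t * th i) *: z i).
      rewrite big_split /= sumr_const scaler_nat mulrnDl; congr (_ + _).
      rewrite -scaler_nat scalerA mulrC -scalerA yE scaler_sumr.
      by apply: eq_bigr => i _; rewrite scalerA.
    have mfar : #|J|%:R * re `|x + t *: y| <= \sum_i re `|x + (t * th i) *: z i|.
      apply: le_trans (re_norm_sum hK _ _); rewrite -sumE re_normZ //.
      by rewrite normr_nat (re_nat hK).
    (* All defects from 2 are nonnegative, so one of them is at most their sum, which is below $|J|
       \cdot e/|J| = e$. *)
    have defect_le : 2 - re `|x + (t * th j) *: z j|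
        <= \sum_i (2 - re `|x + (t * th i) *: z i|).
      rewrite [leRHS](bigD1 j) //= lerDl sumr_ge0 // => i _.
      by rewrite subr_ge0 le2 // normrM t1 th1 mulr1.
    rewrite sumrB sumr_const -[2 *+ _]mulr_natl in defect_le.
    have : #|J|%:R * (2 - e / #|J|%:R) < #|J|%:R * re `|x + t *: y|.
      by rewrite ltr_pM2l.
    rewrite mulrBr mulrCA divff ?gt_eqF // mulr1; lra.
  have : re `|x + (t * th j) *: z j| <= re `|x + z j| + re `|(t * th j - 1) *: z j|.
    have -> : x + (t * th j) *: z j = (x + z j) + (t * th j - 1) *: z j.
      by rewrite scalerBl scale1r addrA addrAC addrK.
    exact: re_normD.
  rewrite re_normZ //.
  have zj1 := re_unit_ball hK (is_ccs_sub_ball hC (Cz j)).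
  have : re `|t * th j - 1| * re `|z j| <= e.
    apply: le_trans jP; rewrite ler_piMr //.
    by have := re_le hK (normr_ge0 (t * th j - 1)); rewrite (re_nat hK 0).
  lra.
(* Used only to see that [C] is nonempty, so that the supremum is not a default value. *)
have [y0 Cy0 _] : exists2 y, C y & 2 - (2^-1 + 2^-1) <= re `|x + y|.
  by apply: near2; lra.
have ne : [set re `|x + y| | y in C] !=set0 by exists (re `|x + y0|), y0.
apply/eqP; rewrite eq_le; apply/andP; split; first exact: ge_sup.
rewrite leNgt; apply/negP => lt2.
set s := sup _ in lt2.
(* With $e \le (2-s)/3$ one gets $2 - 2e > s$, contradicting that [s] is an upper bound; the $1/2$
   ensures $e < 1$. *)
have [|y Cy] := near2 (Num.min (2^-1) ((2 - s) / 3)).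
  rewrite lt_min gt_min; apply/andP; split; [apply/andP; split|apply/orP; left]; lra.
have : re `|x + y| <= s by apply: ub_le_sup; [exists 2 | exists y].
have : Num.min (2^-1) ((2 - s) / 3) <= (2 - s) / 3 by rewrite ge_min lexx orbT.
lra.
Qed.
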